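(* Let $Z$ and $Y$ be real Hilbert spaces, let $X\subset Z$ be nonempty, and let $v\colon X\to Y$ satisfy $$\Big\|v(x_0)-\sum_{i=1}^{k}t_i v(x_i)\Big\|\leq\Big\|x_0-\sum_{i=1}^{k}t_i x_i\Big\|$$ for every positive integer $k$, all $x_0,x_1,\ldots,x_k\in X$, and all $t_1,\ldots,t_k\geq 0$ with $\sum_{i=1}^k t_i=1$. Then for every $L\geq 0$ and every finite-valued convex $L$-Lipschitz function $f\colon Y\to\mathbb R$ there exists a finite-valued convex $L$-Lipschitz function $F\colon Z\to\mathbb R$ such that $$F(x)=f(v(x))\qquad\text{and}\qquad \operatorname{lip}F(x)\leq\operatorname{lip}f(v(x))\qquad\text{for all }x\in X.$$
   Context: For a function $f\colon H\to\mathbb R$ on a Hilbert space $H$, the pointwise local Lipschitz constant is $$\operatorname{lip}f(y)=\limsup_{\substack{z\to y\\ z\neq y}}\frac{|f(z)-f(y)|}{\|z-y\|},$$ with the convention $\operatorname{lip}f(y)=0$ if $y$ is an isolated point (i.e. if $H=\{0\}$). *)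

(* Defs.v *)
From HB Require Import structures.
From mathcomp Require Import all_boot all_order all_algebra sesquilinear.
From mathcomp Require Import all_classical all_reals all_analysis.
Import Order.TTheory GRing.Theory Num.Theory.
Import numFieldNormedType.Exports.

Set Implicit Arguments.
Unset Strict Implicit.
Unset Printing Implicit Defensive.

Local Open Scope classical_set_scope.
Local Open Scope ring_scope.

(* [{dot T for idfun}] is the type of symmetric positive definite bilinear
   forms on T. *)
HB.mixin Record CompleteNormedModule_isHilbert (R : realType) T
    of CompleteNormedModule R T := {
  inner : {dot T for idfun} ;
  inner_norm : forall u : T, inner u u = `|u| ^+ 2
}.

#[short(type="hilbertType")]
HB.structure Definition Hilbert (R : realType) :=
  {T of CompleteNormedModule_isHilbert R T & CompleteNormedModule R T}.

(* The case distinction is needed because at an isolated point y the filter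
   y^' contains the empty set, so that the limit superior along it is -oo. *)
Definition lip (R : realType) (H : normedModType R) (f : H -> R) (y : H) :
    \bar R :=
  if `[< isolated [set: H] y >] then 0%E
  else limf_esup (fun z : H => (`|f z - f y| / `|z - y|)%:E) y^'.

(* Main.v *)
Require Import Defs.
From HB Require Import structures.
From mathcomp Require Import all_boot all_order all_algebra sesquilinear.
From mathcomp Require Import all_classical all_reals all_analysis.
From mathcomp Require Import ring lra.
Import Order.TTheory GRing.Theory Num.Theory.
Import numFieldNormedType.Exports.

Local Open Scope classical_set_scope.
Local Open Scope ring_scope.

(* The extension is
     F(z) = inf_{(p, q) in C} sup {f(w) | `|w - q| <= `|z - p|},
   where C is the convex hull of the graph of v.  The supremum is jointly
   convex in q and the radius and nondecreasing in the radius, so F is convex;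
   it is L-Lipschitz in the radius, so F is L-Lipschitz.  The hypothesis on v
   says that v(x) lies in the ball of center q and radius `|x - p|, so
   F(x) = f(v(x)).  Taking (p, q) = (x, v(x)), F(z) is at most the supremum of
   f on the ball of center v(x) and radius `|z - x|, which bounds the upward
   slopes of F at x by lip f(v(x)); convexity turns this into a bound on the
   downward slopes by reflecting z through x. *)

(** Away from isolated points the punctured filter is proper, so a limit superior of nonnegative
    quotients is nonnegative. This later excludes the value -oo. *)
Lemma lip_ge0 {R : realType} {H : normedModType R} (f : H -> R) (y : H) :
  (0 <= lip f y)%E.
Proof.
rewrite /lip; case: asboolP => // not_iso.
apply: limf_esup_ge0 => [y'0|z]; last by rewrite lee_fin divr_ge0.
apply: not_iso; split; first by rewrite inE.
exists [set y]; last by rewrite setIT.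
move: y'0; rewrite /dnbhs /within /= => y'0.
by apply: filterS y'0 => z /= /negP; rewrite negbK => /eqP.
Qed.

(** The limit superior is an infimum, over punctured neighbourhoods, of suprema; a strict bound [c]
    therefore already holds on one of them. Cleared of the denominator, the inequality is also true
    at [y] itself. *)
Lemma lip_lt_near {R : realType} {H : normedModType R} (f : H -> R) (y : H)
    (c : R) :
  (lip f y < c%:E)%E -> \forall z \near y, `|f z - f y| <= c * `|z - y|.
Proof.
rewrite /lip; case: asboolP => [[_ [V yV Vy]] _|_].
  apply: filterS yV => z Vz.
  have -> : z = y by have : [set y] z by rewrite -Vy.
  by rewrite !subrr !normr0 mulr0.
move=> /ereal_inf_lt[_ [V y'V <-]] Vc.
move: y'V; rewrite /dnbhs /within /= => y'V.
apply: filterS y'V => z Vz.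
have [->|zy] := eqVneq z y; first by rewrite !subrr !normr0 mulr0.
have : ((`|f z - f y| / `|z - y|)%:E <= c%:E)%E.
  apply: le_trans (ltW Vc); apply: ereal_sup_ubound.
  by exists z => //; exact: Vz.
by rewrite lee_fin ler_pdivrMr// normr_gt0 subr_eq0.
Qed.

Lemma near_lip_le {R : realType} {H : normedModType R} (f : H -> R) (y : H)
    (c : R) :
  0 <= c -> (\forall z \near y, `|f z - f y| <= c * `|z - y|) ->
  (lip f y <= c%:E)%E.
Proof.
move=> c0 fc; rewrite /lip; case: asboolP => // _.
pose V := [set z | z != y /\ `|f z - f y| <= c * `|z - y|].
have y'V : y^' V by rewrite /dnbhs /within /=; apply: filterS fc => z ? ?.
apply: le_trans (ereal_inf_lbound _) _; first by exists V.
apply: ge_ereal_sup => _ [z [zy fz] <-].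
by rewrite lee_fin ler_pdivrMr// normr_gt0 subr_eq0.
Qed.

(** The infimum of this set is F(z). Upper bounds [a] stand in for the supremum over the ball, so
    that no supremum has to be shown finite. *)
Definition ball_majorants {R : realType} {Z Y : normedModType R}
    (C : set (Z * Y)) (f : Y -> R) (z : Z) : set R :=
  [set a | exists2 p, C p & forall w, `|w - p.2| <= `|z - p.1| -> f w <= a].

(** Averaging the two pairs gives a center [q], and a radius at most the average [r] of [r1] and
    [r2]. Sharing out the displacement [w - q] in proportion to [r1] and [r2] writes [w] as the same
    average of a point [w1] of the first ball and a point [w2] of the second, where convexity of [f]
    applies. *)
Lemma ball_majorants_conv {R : realType} {Z Y : normedModType R}
    {C : set (Z * Y)} {f : Y -> R} (t : {i01 R}) {z1 z2 : Z} {a1 a2 : R} :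
  convex_set C -> convex_function [set: Y] f ->
  ball_majorants C f z1 a1 -> ball_majorants C f z2 a2 ->
  ball_majorants C f (t%:num *: z1 + (1 - t%:num) *: z2)
    (t%:num * a1 + (1 - t%:num) * a2).
Proof.
move=> Cconv fconv [p1 Cp1 fp1] [p2 Cp2 fp2].
have t0 : 0 <= t%:num by [].
have t1 : 0 <= 1 - t%:num by rewrite subr_ge0.
exists (t%:num *: p1 + (1 - t%:num) *: p2).
  by apply/set_mem; apply: (Cconv p1 p2 t); exact/mem_set.
move=> w /=.
pose p := t%:num *: p1.1 + (1 - t%:num) *: p2.1.
pose q := t%:num *: p1.2 + (1 - t%:num) *: p2.2.
rewrite -/p -/q.
pose r1 := `|z1 - p1.1|; pose r2 := `|z2 - p2.1|.
pose r := t%:num * r1 + (1 - t%:num) * r2.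
move=> wq.
have r10 : 0 <= r1 by exact: normr_ge0.
have r20 : 0 <= r2 by exact: normr_ge0.
have r0 : 0 <= r by rewrite addr_ge0 ?mulr_ge0.
have {}wq : `|w - q| <= r.
  apply: (le_trans wq); rewrite /r /r1 /r2 /p.
  have scale_norm s (u : Z) : 0 <= s -> s * `|u| = `|s *: u|.
    by move=> s0; rewrite normrZ ger0_norm.
  rewrite (scale_norm _ _ t0) (scale_norm _ _ t1).
  apply: le_trans (ler_normD _ _).
  by rewrite !scalerBr opprD addrACA.
(* If r = 0 then w = q and the ratios below are the junk value 0. *)
pose w1 := p1.2 + (r1 / r) *: (w - q); pose w2 := p2.2 + (r2 / r) *: (w - q).
have wE : w = t%:num *: w1 + (1 - t%:num) *: w2.
  (* An opaque name for [w - q] keeps [scalerDr] from distributing over it. *)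
  have [u uE] : exists u, w - q = u by exists (w - q).
  rewrite /w1 /w2 uE.
  rewrite !scalerDr addrACA -/q !scalerA -scalerDl !mulrA -mulrDl -/r.
  have [r_eq0|rn0] := eqVneq r 0; last first.
    by rewrite divff// scale1r -uE addrC subrK.
  rewrite r_eq0 mul0r scale0r addr0; apply/eqP.
  by rewrite -subr_eq0 -normr_le0 -r_eq0.
have ratio s : 0 <= s -> `|(s / r) *: (w - q)| <= s.
  move=> s0; rewrite normrZ ger0_norm ?divr_ge0//.
  have [r_eq0|rn0] := eqVneq r 0; first by rewrite r_eq0 invr0 mulr0 mul0r.
  by rewrite mulrAC ler_pdivrMr ?ler_wpM2l// lt_neqAle eq_sym rn0.
have fw1 : f w1 <= a1 by apply: fp1; rewrite /w1 addrC addKr; exact: ratio.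
have fw2 : f w2 <= a2 by apply: fp2; rewrite /w2 addrC addKr; exact: ratio.
have := fconv t w1 w2; rewrite !inE => /(_ I I) fw.
rewrite wE; apply: (le_trans fw).
by apply: lerD; apply: ler_wpM2l.
Qed.

(** Keep the same pair: moving from [z] to [z'] enlarges the radius by at most [d]. Shrinking [w]
    towards [q] by the factor [c] brings it back into the old ball and moves it by at most [d]. *)
Lemma ball_majorants_lipschitz {R : realType} {Z Y : normedModType R}
    {C : set (Z * Y)} {f : Y -> R} {L : R} {z : Z} (z' : Z) {a : R} :
  0 <= L -> L.-lipschitz f -> ball_majorants C f z a ->
  ball_majorants C f z' (a + L * `|z' - z|).
Proof.
move=> L0 flip [[p q] Cpq fpq]; exists (p, q) => //= w wq.
pose r := `|z - p|; pose d := `|z' - z|; pose c := r / (r + d).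
have r0 : 0 <= r by exact: normr_ge0.
have d0 : 0 <= d by exact: normr_ge0.
have {}wq : `|w - q| <= r + d.
  apply: (le_trans wq); rewrite /r /d [leRHS]addrC.
  by apply: le_trans (ler_normD _ _); rewrite addrA subrK.
have [wc wd] : c * `|w - q| <= r /\ (1 - c) * `|w - q| <= d.
  (* If [r + d] vanishes, then [w = q] and both bounds are trivial. *)
  have [rd0|rdn0] := eqVneq (r + d) 0.
    have -> : `|w - q| = 0.
      by apply/eqP; rewrite -[_ == 0]normr_le0 normr_id -rd0.
    by rewrite !mulr0.
  have rd_gt0 : 0 < r + d by rewrite lt_neqAle eq_sym rdn0 addr_ge0.
  have -> : 1 - c = d / (r + d) by rewrite /c; field.
  by split; rewrite mulrAC ler_pdivrMr// ler_wpM2l.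
have c0 : 0 <= c by rewrite divr_ge0// addr_ge0.
have c1 : 0 <= 1 - c.
  rewrite subr_ge0; have [rd0|rdn0] := eqVneq (r + d) 0.
    by rewrite /c rd0 invr0 mulr0.
  by rewrite ler_pdivrMr ?mul1r ?lerDl// lt_neqAle eq_sym rdn0 addr_ge0.
pose w' := q + c *: (w - q).
have fw' : f w' <= a.
  by apply: fpq => /=; rewrite /w' addrC addKr normrZ ger0_norm.
have := flip (w, w') (conj I I) => /= fw.
have ww' : `|w - w'| <= d.
  have -> : w - w' = (1 - c) *: (w - q).
    by rewrite /w' opprD addrA scalerBl scale1r.
  by rewrite normrZ ger0_norm.
have : f w - f w' <= L * d.
  by apply: le_trans (ler_norm _) (le_trans fw _); exact: ler_wpM2l.
rewrite /d; lra.
Qed.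

(** Here [D] plays the graph of [v] and [C] its convex hull; the contraction hypothesis survives
    only as a comparison of the two coordinate distances from [D] to [C]. *)
Lemma convex_lipschitz_extension {R : realType} {Z Y : normedModType R}
    (C D : set (Z * Y)) (L : R) (f : Y -> R) :
  D !=set0 -> D `<=` C -> convex_set C ->
  (forall x p, D x -> C p -> `|x.2 - p.2| <= `|x.1 - p.1|) ->
  0 <= L -> convex_function [set: Y] f -> L.-lipschitz f ->
  exists F : Z -> R,
    [/\ convex_function [set: Z] F,
        L.-lipschitz F &
        forall x, D x -> F x.1 = f x.2 /\ (lip F x.1 <= lip f x.2)%E].
Proof.
move=> [x0 Dx0] DC Cconv DCle L0 fconv flip.
pose A := ball_majorants C f; pose F z := inf (A z).
have A_ge x a : D x -> A x.1 a -> f x.2 <= a.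
  by move=> Dx [p Cp]; apply; exact: DCle.
(* With [x] itself as the pair, the ball has radius 0 and is the single point [x.2]. *)
have AD x : D x -> A x.1 (f x.2).
  move=> Dx; exists x; first exact: DC.
  by move=> w; rewrite subrr normr0 normr_le0 subr_eq0 => /eqP ->.
have A0 z : A z !=set0.
  exists (f x0.2 + L * `|z - x0.1|).
  by apply: ball_majorants_lipschitz => //; exact: AD.
(* A majorant at [z], transported to [x0.1], is at least [f x0.2] by [A_ge]. *)
have Alb z : has_lbound (A z).
  exists (f x0.2 - L * `|x0.1 - z|) => a Aa; rewrite lerBlDr.
  by apply: A_ge => //; exact: ball_majorants_lipschitz.
have F_le z a : A z a -> F z <= a by move=> Aa; exact: ge_inf.
have F_lt z e : 0 < e -> exists2 a, A z a & a < F z + e.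
  by move=> e0; apply: inf_adherent.
have FD x : D x -> F x.1 = f x.2.
  move=> Dx; apply/eqP; rewrite eq_le F_le//=; last exact: AD.
  by apply: lb_le_inf => // a; exact: A_ge.
have Fconv : convex_function [set: Z] F.
  move=> t z1 z2 _ _; apply/ler_addgt0Pr => e e0.
  have [a1 Aa1 lea1] := F_lt z1 e e0; have [a2 Aa2 lea2] := F_lt z2 e e0.
  have Fa := F_le _ _ (ball_majorants_conv t Cconv fconv Aa1 Aa2).
  have t0 : 0 <= t%:num by [].
  have t1 : 0 <= 1 - t%:num by rewrite subr_ge0.
  rewrite convRE /unstable.onem; apply: (le_trans Fa).
  have := ler_wpM2l t0 (ltW lea1); have := ler_wpM2l t1 (ltW lea2).
  lra.
have Flip1 z z' : F z' - F z <= L * `|z' - z|.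
  rewrite lerBlDl; apply/ler_addgt0Pr => e e0.
  have [a Aa lea] := F_lt z e e0.
  have := F_le _ _ (ball_majorants_lipschitz z' L0 flip Aa); lra.
exists F; split => //.
  move=> [z z'] _ /=; rewrite ler_norml Flip1 andbT lerNl opprB distrC.
  exact: Flip1.
move=> x Dx; split; first exact: FD.
(* Only a finite value [l] needs work: -oo contradicts nonnegativity and +oo bounds everything. *)
have := lip_ge0 f x.2; case: (lip f x.2) (lip_lt_near f x.2) => [l|_ _|//].
  move=> lip_lt; rewrite lee_fin => l0.
  apply/lee_addgt0Pr => e e0; rewrite -EFinD; set c := l + e.
  have c0 : 0 <= c by rewrite addr_ge0// ltW.
  have lc : (l%:E < c%:E)%E by rewrite lte_fin ltrDl.
  have /nbhs_normP[d /= d0 fd] := lip_lt c lc.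
  have Fup z : `|z - x.1| < d -> F z <= F x.1 + c * `|z - x.1|.
    move=> zd; apply: F_le; rewrite FD//.
    exists x; first exact: DC.
    move=> w wz; rewrite -lerBlDl; apply: le_trans (ler_norm _) _.
    apply: le_trans (fd w _) _.
      by rewrite /= distrC; exact: le_lt_trans zd.
    exact: ler_wpM2l.
  apply: near_lip_le => //; apply/nbhs_normP; exists d => //= z /=.
  rewrite distrC => zd; rewrite ler_norml lerBlDl Fup// andbT.
  (* As [x.1] is the midpoint of [z] and [z'], convexity gives 2 F(x.1) <= F(z) + F(z'), and the
     upper bound at [z'] becomes the lower bound at [z]. *)
  pose z' := x.1 + (x.1 - z).
  have z'x : `|z' - x.1| = `|z - x.1| by rewrite /z' addrC addKr distrC.
  have Fz' : F z' <= F x.1 + c * `|z - x.1| by rewrite -z'x Fup ?z'x.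
  have half : (2^-1 : R) \in `[0, 1]%R.
    by rewrite in_itv /= invr_ge0 ler0n invf_le1 ?ler1n.
  have [t tE] : exists t : {i01 R}, t%:num = 2^-1.
    by exists (Itv01 (proj1 (andP half)) (proj2 (andP half))).
  have := Fconv t z z'; rewrite !inE => /(_ I I).
  have -> : conv t (z : convex_lmodType Z) z' = x.1.
    rewrite /conv /= /unstable.onem tE.
    have -> : 1 - 2^-1 = 2^-1 :> R by field.
    rewrite -scalerDr /z' addrCA [z + _]addrC subrK.
    by rewrite -mulr2n -[x.1 *+ 2]scaler_nat scalerA mulVf ?pnatr_eq0// scale1r.
  rewrite convRE /unstable.onem tE; lra.
by rewrite leey.
Qed.

(** The convex hull of the graph of [v], presented by indexed combinations so that the hypothesis on
    [v] applies to it directly. *)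
Definition graph_hull {R : realType} {Z Y : normedModType R} {X : set Z}
    (v : X -> Y) : set (Z * Y) :=
  [set p | exists k (x : 'I_k -> X) (t : 'I_k -> R),
    [/\ forall i, 0 <= t i, \sum_(i < k) t i = 1,
        p.1 = \sum_(i < k) t i *: \val (x i) &
        p.2 = \sum_(i < k) t i *: v (x i)]].

Lemma graph_hull_convex {R : realType} {Z Y : normedModType R} {X : set Z}
    (v : X -> Y) : convex_set (graph_hull v).
Proof.
move=> p q l /set_mem [m [x [t [t0 t1 p1 p2]]]].
move=> /set_mem [n [y [s [s0 s1 q1 q2]]]].
have l0 : 0 <= l%:num by [].
have l1 : 0 <= 1 - l%:num by rewrite subr_ge0.
apply/mem_set; exists (m + n)%N.
(* Concatenate the two families, scaling their weights by [l] and [1 - l]. *)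
exists (fun i => match fintype.split i with inl j => x j | inr j => y j end).
exists (fun i => match fintype.split i with
  inl j => l%:num * t j | inr j => (1 - l%:num) * s j end).
have sL (j : 'I_m) : fintype.split (lshift n j) = inl j.
  exact: (unsplitK (inl j)).
have sR (j : 'I_n) : fintype.split (rshift m j) = inr j.
  exact: (unsplitK (inr j)).
split.
- by move=> i; case: fintype.split => j; rewrite mulr_ge0.
- rewrite big_split_ord /=.
  under eq_bigr do rewrite sL; under [X in _ + X]eq_bigr do rewrite sR.
  by rewrite -!mulr_sumr t1 s1 !mulr1 addrC subrK.
- rewrite big_split_ord /= p1 q1 !scaler_sumr.
  by congr (_ + _); apply: eq_bigr => j _; rewrite ?sL ?sR scalerA.
- rewrite big_split_ord /= p2 q2 !scaler_sumr.
  by congr (_ + _); apply: eq_bigr => j _; rewrite ?sL ?sR scalerA.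
Qed.

Theorem proposition6p2 (R : realType) (Z Y : hilbertType R)
    (X : set Z) (X_neq0 : X !=set0) (v : X -> Y)
    (v_contr : forall k : nat, (0 < k)%N ->
      forall (x0 : X) (x : 'I_k -> X) (t : 'I_k -> R),
        (forall i, 0 <= t i) -> \sum_(i < k) t i = 1 ->
        `|v x0 - \sum_(i < k) t i *: v (x i)|
          <= `|\val x0 - \sum_(i < k) t i *: \val (x i)|) :
  forall L : R, 0 <= L ->
  forall f : Y -> R, convex_function [set: Y] f -> L.-lipschitz f ->
  exists F : Z -> R,
    [/\ convex_function [set: Z] F,
        L.-lipschitz F &
        forall x : X,
          F (\val x) = f (v x) /\ (lip F (\val x) <= lip f (v x))%E].
Proof.
move=> L L0 f fconv flip.
pose D : set (Z * Y) := range (fun x : X => (\val x, v x)).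
have [F [Fconv Flip FD]] : exists F : Z -> R,
    [/\ convex_function [set: Z] F, L.-lipschitz F &
        forall x, D x -> F x.1 = f x.2 /\ (lip F x.1 <= lip f x.2)%E].
  apply: (convex_lipschitz_extension (graph_hull v)) => //.
  - case: X_neq0 => x /mem_set Xx.
    by exists (x, v (exist _ x Xx)), (exist _ x Xx).
  - move=> _ [x _ <-]; exists 1%N, (fun=> x), (fun=> 1).
    by rewrite !big_ord1 !scale1r.
  - exact: graph_hull_convex.
  - move=> _ p [x _ <-] [k [y [t [t0 t1 -> ->]]]] /=.
    (* The case [k = 0] cannot occur: an empty sum of weights is 0, not 1. *)
    apply: v_contr => //; case: k y t t0 t1 => // y t _.
    by rewrite big_ord0 => /esym/eqP; rewrite oner_eq0.
by exists F; split => // x; apply: (FD (\val x, v x)); exists x.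
Qed.
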